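(* Let $f_1,\ldots,f_s\in A=\mathbb{R}[x_1,\ldots,x_n]$ and let $A=\bigoplus_{d\in\mathbb{Z}}A^{(z)}_d$ be the $z$-grading, where $z\in\mathbb{Z}^n$. Then the set $$S(L_z(f_1),\ldots,L_z(f_s))\subseteq\mathbb{R}^n$$ is Zariski-dense in $\mathbb{R}^n$ if and only if the set $S(f_1,\ldots,f_s)\subseteq\mathbb{R}^n$ contains a rational tentacle $T_{K,\varphi}$ of degree $z$ for some compact set $K\subseteq\mathbb{R}^n$ with non-empty interior.
   Context: For $h_1,\ldots,h_s\in A=\mathbb{R}[x_1,\ldots,x_n]$, $S(h_1,\ldots,h_s)=\{x\in\mathbb{R}^n:h_1(x)\geq 0,\ldots,h_s(x)\geq 0\}$. For $z\in\mathbb{Z}^n$ the $z$-grading of $A$ is $A=\bigoplus_{d\in\mathbb{Z}}A^{(z)}_d$, where $A^{(z)}_d$ is the span of the monomials $x_1^{\delta_1}\cdots x_n^{\delta_n}$, $\delta\in\mathbb{N}_0^n$, with $\langle z,\delta\rangle=z_1\delta_1+\cdots+z_n\delta_n=d$. For $f\in A$, $L_z(f)$ is the non-zero homogeneous component of $f$ of highest degree with respect to the $z$-grading (and $L_z(0)=0$). Rational tentacles: for a tuple $\varphi=(\varphi_1,\ldots,\varphi_n)\in\mathbb{R}(\lambda)^n$ of non-zero rational functions in one variable $\lambda$ and a compact set $K\subseteq\mathbb{R}^n$ with non-empty interior, the rational tentacle $T_{K,\varphi}$ is $$T_{K,\varphi}=\{(\varphi_1(\lambda)x_1,\ldots,\varphi_n(\lambda)x_n):\lambda\geq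 1,\ \varphi_1(\lambda),\ldots,\varphi_n(\lambda)\text{ are defined},\ x\in K\}.$$ The degree of a rational function is numerator degree minus denominator degree. A rational tentacle $T$ is of degree $z\in\mathbb{Z}^n$ if there exist a compact set $K\subseteq\mathbb{R}^n$ with non-empty interior and a tuple $\varphi=(\varphi_1,\ldots,\varphi_n)\in\mathbb{R}(\lambda)^n$ of non-zero rational functions with $T=T_{K,\varphi}$ and $(\deg\varphi_1,\ldots,\deg\varphi_n)=z$. *)

(* Defs.v *)
(* The notations of [mpoly] clash with those of MathComp-Analysis, hence its
   restricted import. *)
From HB Require Import structures.
From mathcomp Require Import all_boot all_order all_algebra.
From mathcomp Require Import all_classical all_reals all_analysis.
From mathcomp Require Import -(notations) mpoly.

Set Implicit Arguments.
Unset Strict Implicit.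
Unset Printing Implicit Defensive.

Import Order.TTheory GRing.Theory Num.Theory.
Import numFieldNormedType.Exports.

Local Open Scope classical_set_scope.
Local Open Scope ring_scope.

Notation "{ 'mpoly' R [ n ] }" := (mpoly.mpoly n R)
  (format "{ 'mpoly'  R [ n ] }") : type_scope.

Section Polynomials.
Variables (R : realType) (n : nat).
Implicit Types (p : {mpoly R[n]}) (x : 'rV[R]_n) (z : 'I_n -> int).

Definition eval_at p x : R := meval (fun i => x ord0 i) p.

Definition basic_closed_set (s : nat) (h : 'I_s -> {mpoly R[n]}) :
  set 'rV[R]_n := [set x | forall j, 0 <= eval_at (h j) x].

Definition zero_locus (P : set {mpoly R[n]}) : set 'rV[R]_n :=
  [set x | forall p, P p -> eval_at p x = 0].

Definition zariski_closed (Z : set 'rV[R]_n) : Prop :=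
  exists P, Z = zero_locus P.

Definition zariski_closure (S : set 'rV[R]_n) : set 'rV[R]_n :=
  \bigcap_(Z in [set Z | zariski_closed Z /\ S `<=` Z]) Z.

Definition zariski_dense (S : set 'rV[R]_n) : Prop :=
  zariski_closure S = setT.

Definition zdeg z (delta : multinom n) : int :=
  \sum_(i < n) z i * (delta i)%:Z.

Definition zcomponent z (d : int) p : {mpoly R[n]} :=
  \sum_(m <- msupp p | zdeg z m == d) mcoeff m p *: mpolyX R m.

(* The exponent [mlead p] lies in the support of any non-zero [p]; it serves
   here only as a starting value for the maximum over the support. *)
Definition zdegree z p : int :=
  \big[Num.max / zdeg z (mlead p)]_(m <- msupp p) zdeg z m.

Definition leading_form z p : {mpoly R[n]} := zcomponent z (zdegree z p) p.

Lemma mcoeff_zcomponent z d p m :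
  mcoeff m (zcomponent z d p) = if zdeg z m == d then mcoeff m p else 0.
Proof.
rewrite /zcomponent raddf_sum /=.
under eq_bigr do rewrite mcoeffZ mcoeffX.
have [mp|mp] := boolP (m \in msupp p); last first.
  rewrite (memN_msupp_eq0 mp) if_same big1_seq // => k /andP[_ kp].
  by case: eqP => [km|_]; [rewrite -km kp in mp | rewrite mulr0].
rewrite big_mkcond (bigD1_seq m) ?msupp_uniq //= eqxx mulr1 big1 ?addr0//.
by move=> k /negPf ->; rewrite mulr0 if_same.
Qed.

Lemma leading_form_neq0 z p : p != 0 -> leading_form z p != 0.
Proof.
move=> p0; have lp := mlead_supp p0.
have [m mp zm] : exists2 m, m \in msupp p & zdeg z m = zdegree z p.
  rewrite /zdegree big_seq.
  elim/big_rec: _ => [|k d kp [m mp zm]]; first by exists (mlead p).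
  by case: (leP (zdeg z k) d) => _; [exists m | exists k].
apply: contraTneq mp => L0; rewrite mcoeff_msupp negbK.
by have := mcoeff_zcomponent z (zdegree z p) p m;
  rewrite -/(leading_form z p) L0 mcoeff0 zm eqxx => <-.
Qed.

Lemma leading_form0 z : leading_form z 0 = 0.
Proof. by rewrite /leading_form /zcomponent msupp0 big_nil. Qed.

Lemma zdegree_max z p m : m \in msupp p -> zdeg z m <= zdegree z p.
Proof. by move=> mp; apply: le_bigmax_seq. Qed.

End Polynomials.

Section RationalFunctions.
Variable R : realType.
Implicit Types r : {fraction {poly R}}.

(* Numerator and denominator in lowest terms, so that [r] is defined at [a]
   exactly when [rat_den r] does not vanish there. *)
Definition rat_num r : {poly R} :=
  let nd := repr r in nd.1 %/ gcdp nd.1 nd.2.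

Definition rat_den r : {poly R} :=
  let nd := repr r in nd.2 %/ gcdp nd.1 nd.2.

Definition rat_defined r (a : R) : Prop := (rat_den r).[a] != 0.

Definition rat_eval r (a : R) : R := (rat_num r).[a] / (rat_den r).[a].

(* Meaningful for [r != 0] only: [size] is the degree plus one, and the two
   shifts cancel. *)
Definition rat_deg r : int := (size (rat_num r))%:Z - (size (rat_den r))%:Z.

Lemma coprime_rat_num_den r : coprimep (rat_num r) (rat_den r).
Proof.
by apply: coprimep_div_gcd; rewrite (denom_ratioP (repr r)) orbT.
Qed.

Lemma rat_numK r : rat_num r * gcdp (repr r).1 (repr r).2 = (repr r).1.
Proof. exact: divpK (dvdp_gcdl _ _). Qed.

Lemma rat_denK r : rat_den r * gcdp (repr r).1 (repr r).2 = (repr r).2.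
Proof. exact: divpK (dvdp_gcdr _ _). Qed.

Lemma rat_den_neq0 r : rat_den r != 0.
Proof.
apply: contraNneq (denom_ratioP (repr r)) => den0.
by rewrite -rat_denK den0 mul0r.
Qed.

Lemma rat_num_denE r :
  r = FracField.tofrac (rat_num r) / FracField.tofrac (rat_den r).
Proof.
have nz := denom_ratioP (repr r).
have g0 : gcdp (repr r).1 (repr r).2 != 0 by rewrite gcdp_eq0 negb_and nz orbT.
have rE : r * FracField.tofrac (repr r).2 = FracField.tofrac (repr r).1.
  rewrite -[r in LHS]reprK; unlock FracField.tofrac.
  rewrite -[LHS]FracField.pi_mul /FracField.mulf !numden_Ratio ?oner_neq0 //.
  apply/eqmodP; rewrite /= FracField.equivfE !numden_Ratio ?mulr1 ?oner_neq0 //.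
  by rewrite reprK mulrC.
have d0 : FracField.tofrac (rat_den r) != 0 by rewrite tofrac_eq0 rat_den_neq0.
rewrite -[LHS](mulfK d0); congr (_ / _).
apply: (@mulIf _ (FracField.tofrac (gcdp (repr r).1 (repr r).2))).
  by rewrite tofrac_eq0.
by rewrite -mulrA -!rmorphM rat_denK rat_numK.
Qed.

End RationalFunctions.

Section Tentacles.
Variables (R : realType) (n : nat).
Implicit Types (K T : set 'rV[R]_n) (phi : 'I_n -> {fraction {poly R}}).

Definition tentacle K phi : set 'rV[R]_n :=
  [set y | exists lambda : R, exists x : 'rV[R]_n,
     [/\ 1 <= lambda, forall i, rat_defined (phi i) lambda, K x &
         y = \row_i (rat_eval (phi i) lambda * x ord0 i)]].

Definition tentacle_data K phi : Prop :=
  [/\ compact K, K° !=set0 & forall i, phi i != 0].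

Definition tentacle_of_degree (z : 'I_n -> int) T : Prop :=
  exists K phi, [/\ tentacle_data K phi, T = tentacle K phi &
                    forall i, rat_deg (phi i) = z i].

End Tentacles.

(* Main.v *)
Require Import Defs.
From mathcomp Require Import all_boot all_order all_algebra.
From mathcomp Require Import all_classical all_reals all_analysis.
From mathcomp Require Import -(notations) mpoly.

Set Implicit Arguments.
Unset Strict Implicit.
Unset Printing Implicit Defensive.

Import Order.TTheory GRing.Theory Num.Theory.
Import numFieldNormedType.Exports.

Local Open Scope classical_set_scope.
Local Open Scope ring_scope.

(** The two conditions are linked by one family of polynomials.  If [d] is the
    [z]-degree of [p], the functions
      [deform z p mu y = mu ^ d * p (mu ^ (- z_1) y_1, ..., mu ^ (- z_n) y_n)]
    contain only non-negative powers of [mu], so they extend continuously to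
    [mu = 0], where their value is the leading form of [p] ([deformE],
    [deform0], [cvg_deform]).  With [mu = 1 / lambda], the sign of [p] far out
    along a tentacle of degree [z] is the sign of [deform] near [mu = 0].

    If the leading forms define a dense set, the product of the non-zero ones
    does not vanish on all of that set, hence at some point [x] they are all
    positive ([dense_strict_point]).  By continuity each
    [deform z (f j) mu y] is non-negative for [(mu, y)] close to [(0, x)].  A
    small box around [x] and the functions [(lambda + c) ^ z_i] with [c] large
    then give a tentacle: the shift by [c] keeps [mu = (lambda + c)^-1] small
    for all [lambda >= 1].

    Conversely, a rational function of degree [z_i] behaves at infinity like
    [c_i * lambda ^ z_i] with [c_i != 0] ([cvg_rat_eval]).  Passing to the limit
    along the tentacle through a point [x] of [K] shows that the leading forms
    are non-negative at [(c_1 x_1, ..., c_n x_n)] ([tentacle_leading_ge0]).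
    These points fill a set with interior, and a polynomial that vanishes near
    a point vanishes on every line through that point ([eval_at_line]). *)

(** * Deforming a polynomial to its leading form *)

Section Deformation.
Variables (R : realType) (n : nat).
Implicit Types (p : {mpoly R[n]}) (x y : 'rV[R]_n) (z : 'I_n -> int).

(** The homogenization of [p] for the [z]-grading with [mu] as the extra
    variable.  The exponent is a difference that is non-negative on the support
    of [p], so the absolute value only turns it into a natural number. *)
Definition deform z p (mu : R) y : R :=
  \sum_(m <- msupp p)
    mcoeff m p * mu ^+ `|zdegree z p - zdeg z m|%N *
      \prod_i y ord0 i ^+ (m i).

Lemma eval_atE p x :
  eval_at p x = \sum_(m <- msupp p) mcoeff m p * \prod_i x ord0 i ^+ (m i).
Proof. exact: mevalE. Qed.

Lemma deformE z p (mu : R) y : mu != 0 ->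
  deform z p mu y =
  mu ^ zdegree z p * eval_at p (\row_i (mu ^ (- z i) * y ord0 i)).
Proof.
move=> mu0; have prodX (m : multinom n) :
    \prod_i (mu ^ (- z i)) ^+ (m i) = mu ^ (- zdeg z m).
  rewrite /zdeg -sumrN.
  elim/big_rec2: _ => [|i k a _ ->]; first by rewrite expr0z.
  by rewrite expfzDr // -mulNr -exprz_exp -exprnP.
rewrite eval_atE mulr_sumr /deform; apply: eq_big_seq => m mp.
under [X in _ = _ * (_ * X)]eq_bigr do rewrite mxE exprMn.
rewrite big_split /= prodX exprnP gez0_abs ?subr_ge0 ?zdegree_max //.
by rewrite expfzDr // !mulrA; congr (_ * _); rewrite -!mulrA mulrCA.
Qed.

Lemma deform0 z p y : deform z p 0 y = eval_at (leading_form z p) y.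
Proof.
rewrite /eval_at /leading_form /zcomponent raddf_sum /= big_mkcond.
apply: eq_big_seq => m mp; rewrite expr0n absz_eq0 subr_eq0 eq_sym.
by case: eqP => _; rewrite ?mulr0 ?mul0r // mulr1 mevalZ mevalX.
Qed.

Lemma cvg_deform z p (T : Type) (F : set_system T) (FF : Filter F)
    (mu : T -> R) (y : T -> 'rV[R]_n) (a : R) (b : 'rV[R]_n) :
  mu t @[t --> F] --> a ->
  (forall i, y t ord0 i @[t --> F] --> b ord0 i) ->
  deform z p (mu t) (y t) @[t --> F] --> deform z p a b.
Proof.
have cvgXn (g : T -> R) (l : R) k :
    g t @[t --> F] --> l -> g t ^+ k @[t --> F] --> l ^+ k.
  move=> gl.
  exact: (cvg_comp _ (fun t : R => t ^+ k) gl (@exprn_continuous R k l)).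
move=> mua yb; apply: cvg_big => [|m _]; first exact: add_continuous.
apply: cvgM; first by apply: cvgMl_tmp; exact: cvgXn.
by apply: cvg_big => [|i _]; [exact: mul_continuous | exact: cvgXn].
Qed.

End Deformation.

(** * Polynomials as functions *)

Section PolynomialFunctions.
Variables (R : realType) (n : nat).
Implicit Types (p : {mpoly R[n]}) (x y : 'rV[R]_n) (z : 'I_n -> int).

(** For [mu > 0], [deform z p mu x] is a multiple of a value of [p]; let [mu]
    tend to 0. *)
Lemma eval_at_leading_form_eq0 z p :
  (forall x, eval_at p x = 0) -> forall x, eval_at (leading_form z p) x = 0.
Proof.
move=> p0 x; rewrite -deform0.
have cvgL : deform z p mu x @[mu --> 0^'+] --> deform z p 0 x.
  apply: cvg_deform => [|i]; last exact: cvg_cst.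
  by apply: cvg_at_right_filter; exact: cvg_id.
apply: (cvg_unique (@norm_hausdorff _ R) cvgL).
apply: cvg_near_cst; near=> mu.
by rewrite deformE ?p0 ?mulr0 // gt_eqF //; near: mu; exact: nbhs_right_gt.
Unshelve. all: by end_near. Qed.

(** Induction on the number of monomials.  Two distinct monomials of [p] differ
    in the exponent of some variable [i]; for the degree in that variable, the
    leading form of [p] is non-zero, still vanishes everywhere, and misses one
    of the two monomials.  A single monomial does not vanish at the point with
    all coordinates 1. *)
Lemma eval_at_eq0 p : (forall x, eval_at p x = 0) -> p = 0.
Proof.
have [k] := ubnP (size (msupp p)); elim: k p => // k IH p pk p0.
apply/eqP; apply: contraT => pN0.
have mp := mlead_supp pN0; set m := mlead p in mp.
have [/allP pm|/allPn[m' m'p m'm]] := boolP (all (pred1 m) (msupp p)).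
  have msE : msupp p = [:: m].
    move: pm mp (msupp_uniq p); case: (msupp p) => // a [|b s] pm.
      by rewrite inE => /eqP ->.
    move: (pm a) (pm b); rewrite !inE !eqxx !orbT.
    move=> /(_ isT)/eqP -> /(_ isT)/eqP ->.
    by move=> _; rewrite /= inE eqxx.
  have := p0 (const_mx 1); rewrite eval_atE msE big_seq1.
  under eq_bigr do rewrite mxE expr1n.
  by rewrite big1_eq mulr1 => /eqP; rewrite mcoeff_eq0 mp.
have [i mi] : exists i, m i != m' i.
  apply/existsP; apply: contraNT m'm; rewrite negb_exists => /forallP h.
  by apply/eqP/mnmP => i; apply/esym/eqP; have := h i; rewrite negbK.
pose z (j : 'I_n) : int := (j == i)%:Z.
have zE (l : multinom n) : zdeg z l = l i.
  rewrite /zdeg (bigD1 i) //= /z eqxx mul1r big1 ?addr0 // => j /negPf ->.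
  by rewrite mul0r.
have LN0 := leading_form_neq0 z pN0.
suff L0 : leading_form z p = 0 by rewrite L0 eqxx in LN0.
apply: IH; last exact: eval_at_leading_form_eq0.
rewrite -ltnS; apply: leq_trans pk; rewrite ltnS.
have Lp l : l \in msupp (leading_form z p) ->
    zdeg z l = zdegree z p /\ l \in msupp p.
  rewrite !mcoeff_msupp mcoeff_zcomponent.
  by case: ifP => [/eqP //|_]; rewrite eqxx.
have [l lp lL] : exists2 l, l \in msupp p & l \notin msupp (leading_form z p).
  have [mL|] := boolP (m \in msupp (leading_form z p)); last by exists m.
  exists m' => //; apply: contra mi => m'L.
  by have [] := Lp _ mL; have [] := Lp _ m'L; rewrite !zE => <- _ [->].
apply: (@uniq_leq_size _ (l :: msupp (leading_form z p))).
  by rewrite /= lL msupp_uniq.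
by move=> j; rewrite inE => /predU1P[-> //|/Lp[]].
Qed.

Lemma near0_horner_eq0 (q : {poly R}) :
  (\forall t \near (0 : R), q.[t] = 0) -> q = 0.
Proof.
move=> /nbhs_ballP[e /= e0 qe]; apply/eqP; apply: contraT => q0.
(* More roots in the ball than the degree allows; the shift by 2 keeps them
     strictly inside. *)
pose rs := [seq e / (k.+2)%:R | k <- iota 0 (size q)].
suff : (size rs < size q)%N by rewrite size_map size_iota ltnn.
apply: max_poly_roots => //.
  apply/allP => _ /mapP[k _ ->]; apply/eqP/qe.
  rewrite /ball /= sub0r normrN gtr0_norm ?divr_gt0 ?ltr0n //.
  by rewrite ltr_pdivrMr ?ltr0n // ltr_pMr // ltr1n.
rewrite map_inj_uniq ?iota_uniq // => i j.
move=> /(mulfI (lt0r_neq0 e0)) /invr_inj /eqP.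
by rewrite eqr_nat => /eqP[].
Qed.

(** The restriction of [p] to the line through [x] and [y] is a polynomial in
    [t] that takes the value [p y] at [t = 1]. *)
Lemma eval_at_line p x y :
  (\forall t \near (0 : R), eval_at p (x + t *: (y - x)) = 0) ->
  eval_at p y = 0.
Proof.
pose l i := (x ord0 i)%:P + (y ord0 i - x ord0 i) *: 'X.
pose q : {poly R} := \sum_(m <- msupp p) mcoeff m p *: \prod_i l i ^+ (m i).
have qE t : q.[t] = eval_at p (x + t *: (y - x)).
  rewrite eval_atE horner_sum; apply: eq_bigr => m _.
  rewrite hornerZ horner_prod; congr (_ * _); apply: eq_bigr => i _.
  by rewrite horner_exp !hornerE !mxE mulrC.
move=> p0; have q0 : q = 0.
  by apply: near0_horner_eq0; apply: filterS p0 => t; rewrite qE.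
by have := qE 1; rewrite q0 horner0 scale1r addrC subrK => <-.
Qed.

Lemma zariski_denseP (S : set 'rV[R]_n) :
  zariski_dense S <->
  forall p, (forall x, S x -> eval_at p x = 0) -> forall x, eval_at p x = 0.
Proof.
split=> [dS p pS x|dS].
  have : zariski_closure S x by rewrite dS.
  move=> /(_ (zero_locus [set p])); apply=> //; split; first by exists [set p].
  by move=> y Sy q ->; exact: pS.
apply/seteqP; split=> // x _ Z [[P ->] SP] p Pp.
by apply: dS => y /SP; exact.
Qed.

End PolynomialFunctions.

(** * Rational functions near infinity *)

Section RationalFunctionsAtInfinity.
Variable R : realType.
Implicit Types (r : {fraction {poly R}}) (p q b : {poly R}).

Lemma rat_cross r p q : q != 0 -> r = FracField.tofrac p / FracField.tofrac q ->
  rat_num r * q = p * rat_den r.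
Proof.
move=> q0 rE; apply/eqP; rewrite -tofrac_eq !tofracM.
rewrite -eqr_div ?tofrac_eq0 ?rat_den_neq0 //.
by rewrite -rat_num_denE rE.
Qed.

Lemma rat_num_neq0 r : r != 0 -> rat_num r != 0.
Proof.
by apply: contraNneq => r0; rewrite (rat_num_denE r) r0 tofrac0 mul0r.
Qed.

(** Any fraction that represents [r], reduced or not, computes its values where
    its denominator does not vanish: if the reduced denominator vanished there,
    so would the reduced numerator, against coprimality. *)
Lemma rat_eval_frac r p q a : r = FracField.tofrac p / FracField.tofrac q ->
  q.[a] != 0 -> rat_defined r a /\ rat_eval r a = p.[a] / q.[a].
Proof.
move=> rE qa; have q0 : q != 0 by apply: contraNneq qa => ->; rewrite horner0.
have /(congr1 (horner^~ a)) := rat_cross q0 rE; rewrite !hornerM => cross.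
have da : rat_defined r a.
  have [da|//] := eqVneq (rat_den r).[a] 0.
  apply: (coprimep_root (coprime_rat_num_den r)).
  by rewrite /root -(mulIr_eq0 _ (mulIf qa)) cross da mulr0.
by split=> //; apply/eqP; rewrite /rat_eval eqr_div // cross.
Qed.

Lemma rat_deg_frac r p q : r = FracField.tofrac p / FracField.tofrac q ->
  p != 0 -> q != 0 -> rat_deg r = (size p)%:Z - (size q)%:Z.
Proof.
move=> rE p0 q0; have r0 : r != 0.
  by rewrite rE mulf_neq0 ?invr_eq0 ?tofrac_eq0.
have := rat_cross q0 rE => /(congr1 (size : {poly R} -> nat)).
rewrite !size_mul ?rat_num_neq0 ?rat_den_neq0 // => /(congr1 S).
rewrite !prednK ?addn_gt0 ?size_poly_gt0 ?p0 ?rat_num_neq0 //.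
move=> /(congr1 Posz); rewrite !PoszD => h.
by apply/eqP; rewrite /rat_deg subr_eq addrAC eq_sym subr_eq -h.
Qed.

Lemma rat_eval_exprz b (k : int) a : b.[a] != 0 ->
  rat_defined (FracField.tofrac b ^ k) a /\
  rat_eval (FracField.tofrac b ^ k) a = b.[a] ^ k.
Proof.
case: k => k ba.
- have := @rat_eval_frac (FracField.tofrac b ^ k) (b ^+ k) 1 a.
  rewrite tofrac1 !divr1 tofracXn hornerC horner_exp divr1.
  by apply; rewrite ?oner_neq0.
- have := @rat_eval_frac (FracField.tofrac b ^ Negz k) 1 (b ^+ k.+1) a.
  rewrite tofrac1 !div1r tofracXn hornerC horner_exp div1r.
  by apply; rewrite ?expf_neq0.
Qed.

Lemma rat_deg_exprz b (k : int) : b != 0 ->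
  rat_deg (FracField.tofrac b ^ k) = (size b).-1%:Z * k.
Proof.
move=> b0; have szX l : size (b ^+ l) = ((size b).-1 * l).+1.
  by rewrite -size_exp prednK // size_poly_gt0 expf_neq0.
case: k => k.
- rewrite (@rat_deg_frac _ (b ^+ k) 1) ?expf_neq0 ?oner_neq0 //; last first.
    by rewrite tofrac1 divr1 tofracXn.
  by rewrite szX size_poly1 intS addrAC subrr add0r PoszM.
- rewrite (@rat_deg_frac _ 1 (b ^+ k.+1)) ?expf_neq0 ?oner_neq0 //; last first.
    by rewrite tofrac1 div1r tofracXn.
  by rewrite szX size_poly1 intS opprD addrA subrr sub0r NegzE mulrN PoszM.
Qed.

(** The reciprocal polynomial [X ^ deg p * p (1 / X)]: it moves the behaviour of
    [p] at infinity to the point 0, where its value is the leading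
    coefficient. *)
Definition recip p : {poly R} := \poly_(i < size p) p`_((size p).-1 - i).

Lemma recipE p (mu : R) : mu != 0 ->
  (recip p).[mu] = mu ^+ (size p).-1 * p.[mu^-1].
Proof.
move=> mu0; rewrite horner_poly horner_coef mulr_sumr.
rewrite (reindex_inj rev_ord_inj) /=.
apply: eq_bigr => i _; have ip := ltn_ord i.
have -> : (size p - i.+1 = (size p).-1 - i)%N by rewrite -subn1 -subnDA add1n.
have ip' : (i <= (size p).-1)%N by rewrite -ltnS (ltn_predK ip).
rewrite subKn // mulrCA exprVn; congr (_ * _).
by rewrite -{2}(subnK ip') exprD mulfK // expf_neq0.
Qed.

Lemma recip_at0 p : (recip p).[0] = lead_coef p.
Proof.
rewrite horner_coef0 coef_poly size_poly_gt0 subn0.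
by case: eqVneq => [->|//]; rewrite lead_coef0.
Qed.

Lemma cvg_recip p : (recip p).[mu] @[mu --> 0^'+] --> lead_coef p.
Proof.
by rewrite -recip_at0; apply: cvg_at_right_filter; exact: continuous_horner.
Qed.

Lemma near_rat_defined r : \forall mu \near 0^'+, rat_defined r mu^-1.
Proof.
have lc0 : lead_coef (rat_den r) != 0 by rewrite lead_coef_eq0 rat_den_neq0.
have recip0 := cvgr_neq0 _ (@cvg_recip (rat_den r)) lc0.
near=> mu.
have mu0 : mu != 0 by rewrite gt_eqF //; near: mu; exact: nbhs_right_gt.
have : (recip (rat_den r)).[mu] != 0 by near: mu; exact: recip0.
by rewrite recipE // mulf_eq0 negb_or => /andP[].
Unshelve. all: by end_near. Qed.

Definition rat_lead_coef r : R :=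
  lead_coef (rat_num r) / lead_coef (rat_den r).

Lemma rat_lead_coef_neq0 r : r != 0 -> rat_lead_coef r != 0.
Proof.
move=> r0.
by rewrite mulf_neq0 ?invr_eq0 ?lead_coef_eq0 ?rat_num_neq0 ?rat_den_neq0.
Qed.

(** A non-zero rational function is asymptotic at infinity to the quotient of
    the leading coefficients times [lambda ^ deg r]; here [mu = 1 / lambda]. *)
Lemma cvg_rat_eval r : r != 0 ->
  mu ^ rat_deg r * rat_eval r mu^-1 @[mu --> 0^'+] --> rat_lead_coef r.
Proof.
move=> r0; have nu0 := rat_num_neq0 r0; have de0 := rat_den_neq0 r.
have : (recip (rat_num r)).[mu] / (recip (rat_den r)).[mu] @[mu --> 0^'+] -->
    rat_lead_coef r.
  apply: cvgM; first exact: cvg_recip.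
  by apply: cvgV; [rewrite lead_coef_eq0 | exact: cvg_recip].
apply: cvg_trans; apply: near_eq_cvg; near=> mu.
have mu0 : mu != 0 by rewrite gt_eqF //; near: mu; exact: nbhs_right_gt.
rewrite !recipE // /rat_eval invfM mulrACA; congr (_ * _).
rewrite /rat_deg -(prednK (_ : 0 < size (rat_num r))%N) ?size_poly_gt0 //.
rewrite -[X in _ - X%:Z](prednK (_ : 0 < size (rat_den r))%N) ?size_poly_gt0 //.
by rewrite !intS opprD addrACA subrr add0r expfzDr // -exprnN.
Unshelve. all: by end_near. Qed.

End RationalFunctionsAtInfinity.

(** * Tentacles and dense leading cones *)

Section Tentacles.
Variables (R : realType) (n s : nat) (f : 'I_s -> {mpoly R[n]}).
Variable z : 'I_n -> int.

Let L j := leading_form z (f j).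

(** The product of the non-zero leading forms is a non-zero polynomial, so it
    cannot vanish on a dense set. *)
Lemma dense_strict_point : zariski_dense (basic_closed_set L) ->
  exists x, forall j, f j != 0 -> 0 < eval_at (L j) x.
Proof.
move=> /zariski_denseP dS.
pose g := \prod_(j | f j != 0) L j.
have g0 : g != 0 by apply/prodf_neq0 => j; exact: leading_form_neq0.
have [x Sx gx] : exists2 x, basic_closed_set L x & eval_at g x != 0.
  apply: contrapT => h; move/eqP: g0; apply; apply: eval_at_eq0.
  apply: dS => x Sx.
  by apply/eqP; apply: contraT => gx; case: h; exists x.
exists x => j fj; rewrite lt_neqAle Sx andbT eq_sym.
by move: gx; rewrite /eval_at rmorph_prod => /prodf_neq0; exact.
Qed.

Lemma near_deform_ge0 x : (forall j, f j != 0 -> 0 < eval_at (L j) x) ->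
  \forall u \near (0 : R, x), forall j, 0 <= deform z (f j) u.1 u.2.
Proof.
move=> Lx; apply: (@filter_forall _ _
  (fun j u => 0 <= deform z (f j) u.1 u.2) _ (nbhs_filter _)) => j.
have [fj|/Lx Lj] := eqVneq (f j) 0.
  by apply: nearW => u; rewrite /deform fj msupp0 big_nil.
suff : deform z (f j) u.1 u.2 @[u --> (0 : R, x)] --> eval_at (L j) x.
  by move=> /cvgr_ge; apply.
rewrite -deform0; apply: cvg_deform; first exact: cvg_fst.
move=> i; apply: (cvg_comp _ (fun y : 'rV[R]_n => y ord0 i) cvg_snd).
exact: coord_continuous.
Qed.

Lemma dense_tentacle : zariski_dense (basic_closed_set L) ->
  exists K phi, [/\ tentacle_data K phi, forall i, rat_deg (phi i) = z i &
    tentacle K phi `<=` basic_closed_set f].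
Proof.
move=> /dense_strict_point[x /near_deform_ge0 /nbhs_ballP[e /= e0 xe]].
(* Half of [e] is used because the box is closed and the ball of radius [e]
     open. *)
pose K := [set y : 'rV[R]_n | forall i,
             `[x ord0 i - e / 2, x ord0 i + e / 2]%classic (y ord0 i)].
(* The constant [e^-1] makes [(lambda + e^-1)^-1 < e] for all positive
     [lambda]. *)
pose b : {poly R} := 'X + (e^-1)%:P.
pose phi i := FracField.tofrac b ^ z i.
have b0 : b != 0 by rewrite -size_poly_gt0 size_XaddC.
exists K, phi; split.
- split.
  + apply: (@rV_compact _ _
      (fun i => `[x ord0 i - e / 2, x ord0 i + e / 2]%classic)).
    by move=> i; exact: segment_compact.
  + exists x; apply/nbhs_ballP; exists (e / 2); rewrite /= ?divr_gt0 //.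
    move=> y [_ xy] i; have := xy ord0 i; rewrite /ball /= in_itv /=.
    by rewrite distrC => /ltW; rewrite ler_distl.
  + by move=> i; rewrite expfz_neq0 // tofrac_eq0.
- by move=> i; rewrite rat_deg_exprz // size_XaddC mul1r.
- move=> _ [lambda [y [l1 _ Ky ->]]] j.
  have ba : b.[lambda] = lambda + e^-1 by rewrite !hornerE.
  have ba0 : 0 < b.[lambda].
    by rewrite ba addr_gt0 ?invr_gt0 // (lt_le_trans ltr01).
  have := xe (b.[lambda]^-1, y); rewrite /= => /(_ _ j) h.
  have {h} : 0 <= deform z (f j) b.[lambda]^-1 y.
    apply: h; split; rewrite /=.
      rewrite /ball /= sub0r normrN gtr0_norm ?invr_gt0 //.
      rewrite invf_plt ?posrE // ba ltrDr (lt_le_trans ltr01) //.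
    split=> // k i; rewrite (ord1 k); have := Ky i; rewrite /ball /= in_itv /=.
    rewrite -ler_distl distrC => /le_lt_trans; apply.
    by rewrite ltr_pdivrMr // ltr_pMr // ltr1n.
  rewrite deformE ?invr_eq0 ?gt_eqF // pmulr_rge0 ?exprz_gt0 ?invr_gt0 //.
  congr (0 <= eval_at _ _); apply/rowP => i; rewrite !mxE; congr (_ * _).
  have [_ ->] := rat_eval_exprz (z i) (lt0r_neq0 ba0).
  by rewrite exprz_inv opprK.
Qed.

(** Along [y mu], which converges to the point in question, [deform] is a
    positive multiple of the value of [f j] at the point of the tentacle with
    parameter [1 / mu]; its limit is the leading form. *)
Lemma tentacle_leading_ge0 K phi (x : 'rV[R]_n) :
  (forall i, phi i != 0) -> (forall i, rat_deg (phi i) = z i) ->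
  tentacle K phi `<=` basic_closed_set f -> K x ->
  basic_closed_set L
    (\row_i (rat_lead_coef (phi i) * x ord0 i)).
Proof.
move=> phi0 phiz KS Kx j; rewrite -deform0.
pose y (mu : R) : 'rV[R]_n :=
  \row_i (mu ^ rat_deg (phi i) * rat_eval (phi i) mu^-1 * x ord0 i).
set b := \row_i _.
have : deform z (f j) mu (y mu) @[mu --> 0^'+] --> deform z (f j) 0 b.
  apply: cvg_deform => [|i].
    by apply: cvg_at_right_filter; exact: cvg_id.
  rewrite mxE; under eq_fun do rewrite mxE.
  by apply: cvgMr_tmp; exact: cvg_rat_eval.
move=> /cvgr_to_ge; apply; near=> mu.
have mu0 : 0 < mu by near: mu; exact: nbhs_right_gt.
have mu1 : mu <= 1 by near: mu; exact: nbhs_right_le.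
rewrite deformE ?gt_eqF // pmulr_rge0 ?exprz_gt0 //.
have -> : \row_i (mu ^ (- z i) * y mu ord0 i) =
    \row_i (rat_eval (phi i) mu^-1 * x ord0 i).
  apply/rowP => i; rewrite !mxE phiz !mulrA -expfzDr ?gt_eqF //.
  by rewrite addNr expr0z mul1r.
apply: KS; exists mu^-1, x; split=> //; first by rewrite invf_ge1.
by near: mu; apply: filter_forall => i; exact: near_rat_defined.
Unshelve. all: by end_near. Qed.

Lemma tentacle_dense K phi :
  tentacle_data K phi -> (forall i, rat_deg (phi i) = z i) ->
  tentacle K phi `<=` basic_closed_set f ->
  zariski_dense (basic_closed_set L).
Proof.
move=> [_ [x0 Kx0] phi0] phiz KS; apply/zariski_denseP => p pS y.
pose c i := rat_lead_coef (phi i).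
have c0 i : c i != 0 by exact: rat_lead_coef_neq0.
(* The image of [x1] under the scaling by [c] is [y], so the segment from [x0]
     towards [x1], which starts inside [K], is mapped onto the line used. *)
pose x1 : 'rV[R]_n := \row_i ((c i)^-1 * y ord0 i).
apply: (@eval_at_line _ _ _ (\row_i (c i * x0 ord0 i))).
have near_x0 : x0 + t *: (x1 - x0) @[t --> (0 : R)] --> x0.
  rewrite -[X in _ --> X]addr0 -(scale0r (x1 - x0)).
  by apply: cvgD; [exact: cvg_cst | apply: cvgZr_tmp; exact: cvg_id].
near=> t; apply: pS.
have Kt : K (x0 + t *: (x1 - x0)) by near: t; exact: near_x0.
have := tentacle_leading_ge0 phi0 phiz KS Kt.
congr basic_closed_set; apply/rowP => i; rewrite !mxE -/(c i).
by rewrite mulrDr mulrCA mulrBr mulVKf.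
Unshelve. all: by end_near. Qed.

End Tentacles.

Theorem proposition4p2p8 (R : realType) (n s : nat)
    (f : 'I_s -> {mpoly R[n]}) (z : 'I_n -> int) :
  zariski_dense (basic_closed_set (fun j => leading_form z (f j))) <->
  exists (K : set 'rV[R]_n) (phi : 'I_n -> {fraction {poly R}}),
    [/\ tentacle_data K phi,
        tentacle_of_degree z (tentacle K phi) &
        tentacle K phi `<=` basic_closed_set f].
Proof.
split=> [/dense_tentacle[K [phi [Kphi phiz KS]]]|].
  by exists K, phi; split=> //; exists K, phi.
move=> [K [phi [_ [K' [phi' [Kphi' -> phiz']]]]]].
exact: tentacle_dense.
Qed.
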